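(* Let $T_1,\dots,T_n\in\mathrm{Aut}_{\mathbb{Z}}(\mathbb{Z}^d)$ be commuting unipotent matrices, let $N_j=-\log T_j$, and let $f\colon\mathbb{H}^n\times\mathbb{Z}^d\to\Delta^n\times\mathbb{C}^d$ be the holomorphic map $$f(z_1,\dots,z_n,h)=\bigl(e^{2\pi i z_1},\dots,e^{2\pi i z_n},\,e^{-(z_1N_1+\dots+z_nN_n)}h\bigr).$$ A point of $\Delta^n\times\mathbb{C}^d$ over $(0,\dots,0)\in\Delta^n$ is in the closure of the image of $f$ (taken in $\Delta^n\times\mathbb{C}^d$) if, and only if, it is of the form $$\bigl(0,\dots,0,\,e^{-(w_1N_1+\dots+w_nN_n)}h\bigr),$$ where $h\in\mathbb{Z}^d$ is such that $a_1N_1h+\dots+a_nN_nh=0$ for certain positive integers $a_1,\dots,a_n$, while $w_1,\dots,w_n\in\mathbb{C}$ can be arbitrary complex numbers. Moreover, for each such limit point there is, for suitably small $\varepsilon>0$, an arc $\Delta(\varepsilon)\to\Delta^n\times\mathbb{C}^d$ of the form $$t\mapsto\bigl(t^{a_1}e^{2\pi i w_1},\dots,t^{a_n}e^{2\pi i w_n},\,e^{-(w_1N_1+\dots+w_nN_n)}h\bigr),$$ contained in the image of $f$ for $t\neq0$, and passing through the limit point at $t=0$.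
   Context: $\Delta\subseteq\mathbb{C}$ is the open unit disk, $\Delta(\varepsilon)$ is the open disk of radius $\varepsilon$ around $0$, and $\mathbb{H}$ is the upper half-plane. For a unipotent matrix $T_j$, $N_j=-\log T_j=\sum_{m\ge1}\frac1m(\mathrm{id}-T_j)^m$ (a finite sum); the $N_j$ are commuting nilpotent matrices with rational entries. (Here $T_j$ are the monodromy matrices of a unipotent local system with fiber $\mathbb{Z}^d$ on $(\Delta\setminus\{0\})^n$, and the image of $f$ is the total space of that local system embedded in the total space $\Delta^n\times\mathbb{C}^d$ of Deligne's canonical extension.) *)

(* Defs.v *)
From HB Require Import structures.
From mathcomp Require Import all_boot all_order all_algebra.
From mathcomp Require Import all_classical all_reals all_analysis.
From mathcomp Require Import complex.

Set Implicit Arguments.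
Unset Strict Implicit.
Unset Printing Implicit Defensive.

Import Order.TTheory GRing.Theory Num.Theory.
Import numFieldNormedType.Exports.

Local Open Scope classical_set_scope.
Local Open Scope ring_scope.

(* Going through [numClosedFieldType] lets the field R[i] inherit the topology
   that MathComp-Analysis attaches to every numeric field. *)
Definition C (R : realType) : numClosedFieldType := R[i].

Section UnipotentLogarithm.
Variable d : nat.

Definition unipotent (S : pzRingType) (A : 'M[S]_d) : Prop :=
  exists k : nat, (1%:M - A) ^+ k = 0.

(* N = - log A.  For unipotent A all terms with m > d vanish, so this is the
   whole series; see [nlog_series] below. *)
Definition nlog (F : fieldType) (A : 'M[F]_d) : 'M[F]_d :=
  \sum_(1 <= m < d.+1) m%:R^-1 *: (1%:M - A) ^+ m.

Lemma nilpotent_exp_dim (F : fieldType) (A : 'M[F]_d) (k : nat) :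
  A ^+ k = 0 -> A ^+ d = 0.
Proof.
case: d A => [|n] A Ak; first by apply/matrixP => -[].
have : mxminpoly A %| ('X - 0%:P) ^+ k.
  by rewrite subr0 dvd_mxminpoly rmorphXn /= horner_mx_X Ak.
case/dvdp_exp_XsubCP => j _; rewrite subr0 => Aj.
have jn : (j <= n.+1)%N.
  have := dvdp_leq (monic_neq0 (char_poly_monic A)) (mxminpoly_dvd_char A).
  by rewrite (eqp_size Aj) size_polyXn size_char_poly ltnS.
have := dvdp_exp2l ('X : {poly F}) jn; rewrite -(eqp_dvdl _ Aj) => /mxminpoly_minP.
by rewrite rmorphXn /= horner_mx_X.
Qed.

Lemma nlog_series (F : fieldType) (A : 'M[F]_d) (M : nat) :
  unipotent A -> (d <= M)%N ->
  \sum_(1 <= m < M.+1) m%:R^-1 *: (1%:M - A) ^+ m = nlog A.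
Proof.
move=> [k /nilpotent_exp_dim Ad0] dM.
rewrite /nlog (@big_cat_nat _ _ _ d.+1 1 M.+1) //=.
rewrite [X in _ + X]big1_seq ?addr0 // => m.
rewrite mem_index_iota => /andP[_ /andP[dm _]].
by rewrite -(subnK (ltnW dm)) exprD Ad0 mulr0 scaler0.
Qed.

End UnipotentLogarithm.

Section ComplexExponentials.
Variable R : realType.

Definition cexp (z : C R) : C R :=
  ((expR (complex.Re z) * cos (complex.Im z))
  +i* (expR (complex.Re z) * sin (complex.Im z)))%C.

Definition e2pii (z : C R) : C R := cexp (2 * (pi : R)%:C%C * 'i * z).

Definition mexp (d : nat) (A : 'M[C R]_d) : 'M[C R]_d :=
  lim (series (fun k => k`!%:R^-1 *: A ^+ k) @ \oo).

End ComplexExponentials.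

Section CanonicalExtension.
Variables (R : realType) (n d : nat) (T : 'I_n -> 'M[int]_d).

Definition monodromy_N (j : 'I_n) : 'M[C R]_d := nlog (map_mx intr (T j)).

Definition vecC (h : 'cV[int]_d) : 'cV[C R]_d := map_mx intr h.

Definition expN (w : 'rV[C R]_n) (h : 'cV[int]_d) : 'cV[C R]_d :=
  mexp (- \sum_j w 0 j *: monodromy_N j) *m vecC h.

Definition upper_half_space : set 'rV[C R]_n :=
  [set z : 'rV[C R]_n | forall j, 0 < complex.Im (z 0 j : C R)].

Definition polydisk : set 'rV[C R]_n := [set q : 'rV[C R]_n | forall j, `|q 0 j| < 1].

Definition disk_bundle : set ('rV[C R]_n * 'cV[C R]_d) :=
  polydisk `*` setT.

Definition embedding (zh : 'rV[C R]_n * 'cV[int]_d)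
    : 'rV[C R]_n * 'cV[C R]_d :=
  (\row_j e2pii (zh.1 0 j), expN zh.1 zh.2).

Definition embedding_image : set ('rV[C R]_n * 'cV[C R]_d) :=
  embedding @` (upper_half_space `*` setT).

(* Closure in the subspace topology of Delta^n x C^d; [subspace A] is the whole
   type, with the points outside A made isolated. *)
Definition embedding_closure : set ('rV[C R]_n * 'cV[C R]_d) :=
  closure (embedding_image : set (subspace disk_bundle)).

Definition positive_relation (a : 'I_n -> nat) (h : 'cV[int]_d) : Prop :=
  (forall j, (0 < a j)%N) /\ \sum_j (a j)%:R *: (monodromy_N j *m vecC h) = 0.

Definition limit_arc (a : 'I_n -> nat) (w : 'rV[C R]_n) (h : 'cV[int]_d) (t : C R)
    : 'rV[C R]_n * 'cV[C R]_d :=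
  (\row_j (t ^+ a j * e2pii (w 0 j)), expN w h).

End CanonicalExtension.

(* Main.v *)
(* Put N(y) = sum_j y_j N_j.  Suppose exp(-N(z)) h has a limit while every Im z_j
   tends to infinity, along an ultrafilter.  Some exp(-D k_j N_j), with D fixed and
   the k_j integers, preserves the lattice, so Re z_j may be taken in a compact
   interval and absorbed into the limit; this leaves exp(-i N(y)) h with y real.
   Take a longest product of N's that does not kill h.  Dropping its first factor
   leaves q with q exp(-i N(y)) h = q h - i N(y) q h.  The real part is a convergent
   sequence of rational vectors with bounded denominators, hence q h is eventually a
   constant g; the imaginary part N(y) g converges, so y stays at bounded distance
   from the rational subspace {y | N(y) g = 0}.  Moving y into this proper subspace
   and iterating on its dimension, h becomes constant and y = y' + b with b convergent
   and y' in a rational subspace where N(y') h = 0.  As y' is eventually positive,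
   that subspace contains a positive integral vector a, and the limit is
   exp(-i N(lim b)) h. *)
Require Import Defs.
From mathcomp Require Import all_boot all_order all_algebra.
From mathcomp Require Import all_classical all_reals all_analysis.
From mathcomp Require Import complex ring.

Set Implicit Arguments.
Unset Strict Implicit.
Unset Printing Implicit Defensive.

Import Order.TTheory GRing.Theory Num.Theory.
Import numFieldNormedType.Exports.

Local Open Scope classical_set_scope.
Local Open Scope ring_scope.

(** * Exponentials of nilpotent matrices *)

Section TruncatedExponential.
Variables (F : numFieldType) (d : nat).
Implicit Types A B : 'M[F]_d.

(* The terms of index d and d + 1 vanish when A ^+ d = 0; with them the formula
   texp X *m v = v + X *m v for X ^ 2 v = 0 holds for every d. *)
Definition texp A : 'M[F]_d := \sum_(k < d.+2) k`!%:R^-1 *: A ^+ k.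

Lemma nilpotent_exp_ge A k : A ^+ d = 0 -> (d <= k)%N -> A ^+ k = 0.
Proof. by move=> Ad0 dk; rewrite -(subnK dk) exprD Ad0 mulr0. Qed.

Lemma texp_widen A K : A ^+ d = 0 -> (d <= K)%N ->
  \sum_(0 <= k < K) k`!%:R^-1 *: A ^+ k = texp A.
Proof.
move=> Ad0; rewrite /texp -(big_mkord xpredT (fun k => k`!%:R^-1 *: A ^+ k)).
suff trunc L : (d <= L)%N -> \sum_(0 <= k < L) k`!%:R^-1 *: A ^+ k =
    \sum_(0 <= k < d) k`!%:R^-1 *: A ^+ k.
  by move=> dK; rewrite !trunc // ltnW.
move=> dL; rewrite (@big_cat_nat _ _ _ d 0 L) //=.
rewrite [X in _ + X]big_nat [X in _ + X]big1 ?addr0 // => m /andP[dm _].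
by rewrite (nilpotent_exp_ge Ad0 dm) scaler0.
Qed.

(** The binomial formula only gives vanishing of the power [d + d]; [nilpotent_exp_dim] brings the
    exponent back to the size [d] of the matrices. *)
Lemma nilpotentD A B : GRing.comm A B -> A ^+ d = 0 -> B ^+ d = 0 ->
  (A + B) ^+ d = 0.
Proof.
move=> cAB Ad0 Bd0; apply: (@nilpotent_exp_dim _ _ _ (d + d)%N).
rewrite exprDn_comm //; apply: big1 => -[i /= id] _.
case: (leqP d i) => di.
  by rewrite (nilpotent_exp_ge Bd0 di) mulr0 mul0rn.
rewrite (nilpotent_exp_ge Ad0) ?mul0r ?mul0rn //.
by rewrite -addnBA ?leq_addr // ltnW.
Qed.

Lemma exprZ_mx (c : F) A k : (c *: A) ^+ k = c ^+ k *: A ^+ k.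
Proof.
elim: k => [|k IH]; first by rewrite !expr0 scale1r.
by rewrite !exprS IH -!mulmxE -scalemxAl -scalemxAr scalerA.
Qed.

Lemma nilpotentZ (c : F) A : A ^+ d = 0 -> (c *: A) ^+ d = 0.
Proof. by move=> Ad0; rewrite exprZ_mx Ad0 scaler0. Qed.

Lemma commr_scale (c : F) A B : GRing.comm A B -> GRing.comm A (c *: B).
Proof.
by move=> cAB; rewrite /GRing.comm -!mulmxE -scalemxAl -scalemxAr mulmxE cAB.
Qed.

Lemma commr_lin_sum (I : finType) (A : 'M[F]_d) (B : I -> 'M[F]_d) (c : I -> F) :
  (forall i, GRing.comm A (B i)) -> GRing.comm A (\sum_i c i *: B i).
Proof.
by move=> cAB; apply: commr_sum => i _; apply: commr_scale.
Qed.

Lemma nilpotent_sum (I : finType) (B : I -> 'M[F]_d) (c : I -> F) :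
  (forall i j, GRing.comm (B i) (B j)) -> (forall i, B i ^+ d = 0) ->
  (\sum_i c i *: B i) ^+ d = 0.
Proof.
move=> cB Bd0; have Z0 : (0 : 'M[F]_d) ^+ d = 0.
  by apply: (@nilpotent_exp_dim _ _ _ 1); rewrite expr1.
suff [] : (\sum_i c i *: B i) ^+ d = 0 /\
  forall j, GRing.comm (B j) (\sum_i c i *: B i) by [].
apply: (big_rec (fun X => X ^+ d = 0 /\ forall j, GRing.comm (B j) X)).
  by split=> [//|j]; apply: commr0.
move=> i X _ [Xd0 cX]; split.
  apply: nilpotentD => //; last exact: nilpotentZ.
  exact/commr_sym/commr_scale/commr_sym/cX.
by move=> j; apply: commrD => //; apply: commr_scale.
Qed.

(** Cauchy product. The series of [A + B] is summed up to [d + d], so that the triangle of index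
    pairs contains the square where both indices are below [d]; outside this square a power of [A]
    or of [B] vanishes. *)
Lemma texpD A B : GRing.comm A B -> A ^+ d = 0 -> B ^+ d = 0 ->
  texp (A + B) = texp A * texp B.
Proof.
move=> cAB Ad0 Bd0; have ABd0 := nilpotentD cAB Ad0 Bd0.
rewrite -(texp_widen (K := d + d) ABd0) ?leq_addr //.
pose a i := i`!%:R^-1 *: A ^+ i; pose b i := i`!%:R^-1 *: B ^+ i.
have -> : \sum_(0 <= k < d + d) k`!%:R^-1 *: (A + B) ^+ k =
    \sum_(0 <= k < d + d) \sum_(0 <= i < d + d | (i <= k)%N) a (k - i)%N * b i.
  apply: eq_big_nat => k /andP[_ kd].
  rewrite exprDn_comm // scaler_sumr.
  rewrite -(big_mkord xpredT
    (fun i => k`!%:R^-1 *: (A ^+ (k - i) * B ^+ i *+ 'C(k, i)))).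
  rewrite (big_nat_widen 0 k.+1 (d + d)) //=.
  rewrite big_nat_cond [RHS]big_nat_cond; apply: eq_bigr => i /andP[_].
  rewrite ltnS /a /b => ik.
  rewrite -!mulmxE -scalemxAl -scalemxAr scalerA.
  rewrite -(@scaler_nat F _ _ (A ^+ (k - i) * B ^+ i)) scalerA.
  congr (_ *: _); rewrite -(bin_fact ik) !natrM.
  by rewrite !invfM mulrC mulVKf ?pnatr_eq0 -?lt0n ?bin_gt0 // mulrC.
rewrite (exchange_big_dep_nat xpredT) //=.
rewrite -(texp_widen (A := A) (K := d)) //.
rewrite -(texp_widen (A := B) (K := d)) // -/(a _) -/(b _).
rewrite mulr_sumr (@big_cat_nat _ _ _ d 0 (d + d)) ?leq_addr //=.
rewrite [X in _ + X]big_nat [X in _ + X]big1 ?addr0 => [|i /andP[di _]]; last first.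
  apply: big1 => j _; rewrite /b (nilpotent_exp_ge Bd0 di).
  by rewrite scaler0 mulr0.
apply: eq_big_nat => i /andP[_ id]; rewrite -mulr_suml; congr (_ * _).
transitivity (\sum_(i <= k < d + d) a (k - i)%N).
  rewrite (@big_cat_nat _ _ _ i 0 (d + d)) //=; last exact: ltnW (ltn_addr _ _).
  rewrite [X in X + _]big_nat_cond [X in X + _]big1 ?add0r; last first.
    move=> k /andP[/andP[_ ki] ik].
    by rewrite ltnNge ik in ki.
  rewrite big_nat_cond [RHS]big_nat; apply: eq_bigl => k.
  by case: (i <= k)%N; rewrite ?andbT ?andbF.
rewrite -[X in \sum_(X <= _ < _) _]add0n big_addn.
under eq_bigr do rewrite addnK.
rewrite (texp_widen (A := A) (K := d)) // (texp_widen (A := A)) //.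
by rewrite -addnBA ?leq_addr //; exact: ltnW.
Qed.

Lemma texp0 : texp 0 = 1.
Proof.
rewrite /texp big_ord_recl big1 ?addr0 /= ?expr0 ?invr1 ?scale1r //.
by move=> i _; rewrite /= expr0n /= scaler0.
Qed.

End TruncatedExponential.

(** By the pigeonhole principle some letter occurs at least [d] times, and commutation gathers its
    occurrences in front. *)
Lemma word_nilpotent (R : pzRingType) (n d : nat) (A : 'I_n -> R) (w : seq 'I_n) :
  (forall i j, GRing.comm (A i) (A j)) -> (forall i, A i ^+ d = 0) ->
  (n * d < size w)%N -> \prod_(i <- w) A i = 0.
Proof.
move=> cA Ad0 szw.
have pull j : \prod_(i <- w) A i =
    A j ^+ count_mem j w * \prod_(i <- w | i != j) A i.
  elim: w {szw} => [|k w IH]; first by rewrite !big_nil mulr1.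
  rewrite !big_cons IH /=; case: eqVneq => [->|kj] /=; rewrite ?exprS ?mulrA //.
  by congr (_ * _); apply: commrX.
have [j dj] : exists j, (d <= count_mem j w)%N.
  apply/existsP; apply: contraTT szw => /existsPn small.
  have -> : size w = (\sum_j count_mem j w)%N.
    rewrite -sum1_size (partition_big id xpredT) //=; apply: eq_bigr => j _.
    by rewrite sum1_count.
  rewrite -leqNgt (@leq_trans (\sum_(j < n) d)%N) //.
    by apply: leq_sum => j _; rewrite ltnW // ltnNge small.
  by rewrite sum_nat_const card_ord.
by rewrite (pull j) -(subnK dj) exprD Ad0 mulr0 mul0r.
Qed.

Lemma rat_mx_clear (m n : nat) (A : 'M[rat]_(m, n)) :
  exists (D : nat) (B : 'M[int]_(m, n)),
    (0 < D)%N /\ D%:R *: A = map_mx intr B.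
Proof.
pose D := (\prod_i \prod_j `|denq (A i j)|)%N.
have D_gt0 : (0 < D)%N.
  by rewrite prodn_gt0 // => i; rewrite prodn_gt0 // => j; rewrite absz_gt0 denq_neq0.
exists D, (\matrix_(i, j) (numq (A i j) * (D %/ `|denq (A i j)|)%N)); split=> //.
apply/matrixP => i j; rewrite !mxE rmorphM /= -pmulrn.
have dvd : (`|denq (A i j)| %| D)%N.
  by rewrite /D (bigD1 i) //= (bigD1 j) //= -mulnA dvdn_mulr.
rewrite numqE -{1}(divnK dvd) natrM natr_absz (gtr0_norm (denq_gt0 _)).
by rewrite -mulrA mulrC [X in X * _]mulrC.
Qed.

Unset Implicit Arguments.

(** * Entrywise limits of matrices along a filter *)

Section EntrywiseLimits.
Context {K : numFieldType} {I : Type} {F : set_system I} {FF : ProperFilter F}.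

Definition mxlim {m n} (u : I -> 'M[K]_(m, n)) (l : 'M[K]_(m, n)) :=
  forall i j, u x i j @[x --> F] --> l i j.

Lemma cvg_finsum (J : Type) (r : seq J) (f : J -> I -> K) (l : J -> K) :
  (forall j, f j x @[x --> F] --> l j) ->
  \sum_(j <- r) f j x @[x --> F] --> \sum_(j <- r) l j.
Proof.
move=> fl; elim: r => [|j r IH].
  by rewrite big_nil; under eq_fun do rewrite big_nil; apply: cvg_cst.
rewrite big_cons; under eq_fun do rewrite big_cons.
exact: cvgD.
Qed.

Lemma mxlim_cst {m n} (l : 'M[K]_(m, n)) : mxlim (fun=> l) l.
Proof. by move=> i j; apply: cvg_cst. Qed.

Lemma mxlim_near {m n} {u v : I -> 'M[K]_(m, n)} {l} :
  (\forall x \near F, u x = v x) -> mxlim u l -> mxlim v l.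
Proof.
move=> uv ul i j; apply: cvg_trans (ul i j); apply: near_eq_cvg.
by near=> x; congr (fun_of_matrix _ i j); near: x; apply: filterS uv => x ->.
Unshelve. all: by end_near. Qed.

Lemma mxlimD {m n} {u v : I -> 'M[K]_(m, n)} {l k} :
  mxlim u l -> mxlim v k -> mxlim (fun x => u x + v x) (l + k).
Proof.
move=> ul vk i j; rewrite mxE; under eq_fun do rewrite mxE.
by apply: cvgD.
Qed.

Lemma mxlim_sum {J : finType} {m n} {u : J -> I -> 'M[K]_(m, n)} {l} :
  (forall j, mxlim (u j) (l j)) ->
  mxlim (fun x => \sum_j u j x) (\sum_j l j).
Proof.
move=> ul a b; rewrite summxE; under eq_fun do rewrite summxE.
by apply: cvg_finsum => j; apply: ul.
Qed.

Lemma mxlimM {m n p} {u : I -> 'M[K]_(m, n)} {v : I -> 'M[K]_(n, p)} {l k} :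
  mxlim u l -> mxlim v k -> mxlim (fun x => u x *m v x) (l *m k).
Proof.
move=> ul vk i j; rewrite mxE; under eq_fun do rewrite mxE.
by apply: cvg_finsum => a; apply: cvgM.
Qed.

Lemma mxlimZ {m n} {c : I -> K} {u : I -> 'M[K]_(m, n)} {a : K} {l} :
  c x @[x --> F] --> a -> mxlim u l -> mxlim (fun x => c x *: u x) (a *: l).
Proof.
move=> ca ul i j; rewrite mxE; under eq_fun do rewrite mxE.
by apply: cvgM.
Qed.

Lemma mxlimZl {m n} (a : K) {u : I -> 'M[K]_(m, n)} {l} :
  mxlim u l -> mxlim (fun x => a *: u x) (a *: l).
Proof. by apply: mxlimZ; apply: cvg_cst. Qed.

Lemma mxlim_unique {m n} {u : I -> 'M[K]_(m, n)} {l k} :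
  mxlim u l -> mxlim u k -> l = k.
Proof.
move=> ul uk; apply/matrixP => i j; apply: cvg_unique (ul i j) (uk i j).
exact: norm_hausdorff.
Qed.

Lemma mxlimX {d} {u : I -> 'M[K]_d} {l} k :
  mxlim u l -> mxlim (fun x => u x ^+ k) (l ^+ k).
Proof.
move=> ul; elim: k => [|k IH]; first exact: mxlim_cst.
by rewrite exprS; under eq_fun do rewrite exprS; apply: mxlimM.
Qed.

Lemma mxlim_texp {d} {u : I -> 'M[K]_d} {l} :
  mxlim u l -> mxlim (fun x => texp (u x)) (texp l).
Proof.
move=> ul; apply: mxlim_sum => j; apply: mxlimZ; first exact: cvg_cst.
exact: mxlimX.
Qed.

End EntrywiseLimits.

Arguments mxlim {K I} F {m n}.

(** * Real and imaginary parts of limits, and limits of integral vectors *)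

Section RealPart.
Context {K : numClosedFieldType} {I : Type} {F : set_system I} {FF : ProperFilter F}.

Lemma cvg_conj {f : I -> K} {l} :
  f x @[x --> F] --> l -> (f x)^* @[x --> F] --> l^*.
Proof.
move=> /cvgrPdist_lt fl; apply/cvgrPdist_lt => e e0.
by apply: filterS (fl e e0) => x; rewrite -rmorphB /= norm_conjC.
Qed.

(** Complex conjugation is continuous, so [u + 'i *: v] converges too; [u] and [v] are linear
    combinations of the two conjugate families. *)
Lemma mxlim_real_imag {m n} {u v : I -> 'M[K]_(m, n)} {l} :
  (forall x i j, u x i j \is Num.real) -> (forall x i j, v x i j \is Num.real) ->
  mxlim F (fun x => u x - 'i *: v x) l ->
  exists lu lv, mxlim F u lu /\ mxlim F v lv.
Proof.
move=> ur vr wl.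
pose c := map_mx (Num.conj : K -> K) l.
have cl : mxlim F (fun x => u x + 'i *: v x) c.
  move=> i j; rewrite mxE; apply: cvg_trans (cvg_conj (wl i j)).
  apply: near_eq_cvg; near=> x; rewrite !mxE rmorphB rmorphM /= conjCi.
  by rewrite !conj_Creal // mulNr opprK.
exists (2^-1 *: (l + c)), (('i / 2) *: (l - c)); split=> i j.
  have wi : mxlim F (fun x => 2^-1 *: (u x - 'i *: v x + (u x + 'i *: v x)))
      (2^-1 *: (l + c)) by apply: mxlimZl; apply: mxlimD.
  have := wi i j.
  apply: cvg_trans; apply: near_eq_cvg; near=> x; rewrite !mxE.
  by rewrite addrACA addNr addr0 -mulr2n -(mulr_natl (u x i j)) mulKf ?pnatr_eq0.
have wi : mxlim F (fun x => ('i / 2) *: (u x - 'i *: v x + -1 *: (u x + 'i *: v x)))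
    (('i / 2) *: (l - c)).
  by apply: mxlimZl; apply: mxlimD => //; rewrite -[- c]scaleN1r; apply: mxlimZl.
have := wi i j.
apply: cvg_trans; apply: near_eq_cvg; near=> x; rewrite !mxE.
rewrite mulN1r opprD addrACA subrr add0r -mulr2n -(mulr_natl (- _)).
by rewrite mulrA divfK ?pnatr_eq0 // mulrN mulrA -expr2 sqrCi mulN1r opprK.
Unshelve. all: by end_near. Qed.

End RealPart.

Section Integrality.
Context {K : numFieldType} {I : Type} {F : set_system I} {FF : ProperFilter F}.

(** Two integers within 1/2 of the same limit differ by less than 1. *)
Lemma int_lim_eventually_cst {f : I -> int} {l : K} :
  (f x)%:~R @[x --> F] --> l -> exists c, \forall x \near F, f x = c.
Proof.
move=> /cvgrPdist_lt /(_ 2^-1); rewrite invr_gt0 ltr0n => /(_ isT) fl.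
have [x0 fx0] := filter_ex fl; exists (f x0); apply: filterS fl => x fx.
have : `|(f x - f x0)%:~R : K| < 1.
  rewrite intrB -(subrKA l) (le_lt_trans (ler_normD _ _)) //.
  rewrite distrC (lt_le_trans (ltrD fx fx0)) //.
  by rewrite -[2^-1]div1r -splitr.
rewrite -intr_norm (ltr_int _ _ 1) -[1]add0r ltzD1 normr_le0 subr_eq0.
by move/eqP.
Qed.

(** Since [A] is fixed, one integer [D] clears the denominators for all [x], and convergent integers
    are eventually constant. *)
Lemma rat_image_eventually_cst {m d} {A : 'M[rat]_(m, d)} {h : I -> 'cV[int]_d}
    {l : 'cV[K]_m} :
  mxlim F (fun x => map_mx ratr (A *m map_mx intr (h x))) l ->
  exists g, \forall x \near F, A *m map_mx intr (h x) = g.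
Proof.
move=> Al; have [D [B [D0 DB]]] := rat_mx_clear A.
have Ah x : D%:R *: (A *m map_mx intr (h x)) = map_mx intr (B *m h x).
  by rewrite scalemxAl DB map_mxM.
have [c Bc] : exists c : 'I_m -> int, forall i, \forall x \near F, (B *m h x) i 0 = c i.
  apply: (@fin_all_exists _ (fun=> int)
    (fun i ci => \forall x \near F, (B *m h x) i 0 = ci)) => i.
  apply: (int_lim_eventually_cst (l := D%:R * l i 0)).
  apply: cvg_trans (cvgM (cvg_cst (D%:R : K)) (Al i 0)).
  apply: near_eq_cvg; near=> x; rewrite /= [X in _ * X = _]mxE.
  have /matrixP/(_ i 0) := Ah x; rewrite mxE [RHS]mxE => /(congr1 (ratr : rat -> K)).
  by rewrite rmorphM /= ratr_nat ratr_int.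
exists (D%:R^-1 *: map_mx intr (\col_i c i)).
have {}Bc : \forall x \near F, forall i, (B *m h x) i 0 = c i by apply: filter_forall.
apply: filterS Bc => x Bx.
have Dn0 : D%:R != 0 :> rat by rewrite pnatr_eq0 -lt0n.
apply: (scalerI Dn0); rewrite Ah scalerA mulfV // scale1r.
by congr map_mx; apply/colP => i; rewrite Bx mxE.
Unshelve. all: by end_near. Qed.

End Integrality.

(** * Linear combinations of commuting nilpotent matrices and the action of their exponentials *)

Set Implicit Arguments.

Definition lincomb (F : numFieldType) n d (B : 'I_n -> 'M[F]_d) (y : 'rV[F]_n) :=
  \sum_j y 0 j *: B j.

Section LinearCombinations.
Variables (F : numFieldType) (n d : nat) (B : 'I_n -> 'M[F]_d).
Hypotheses (cB : forall i j, GRing.comm (B i) (B j)) (B0 : forall j, B j ^+ d = 0).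
Implicit Types y z : 'rV[F]_n.

Lemma lincombD y z : lincomb B (y + z) = lincomb B y + lincomb B z.
Proof.
by rewrite -big_split; apply: eq_bigr => j _; rewrite mxE scalerDl.
Qed.

Lemma lincombZ c y : lincomb B (c *: y) = c *: lincomb B y.
Proof.
by rewrite scaler_sumr; apply: eq_bigr => j _; rewrite mxE scalerA.
Qed.

Lemma lincombN y : lincomb B (- y) = - lincomb B y.
Proof. by rewrite -scaleN1r lincombZ scaleN1r. Qed.

Lemma lincomb_mul m (s : 'rV[F]_m) (E : 'M[F]_(m, n)) :
  lincomb B (s *m E) = \sum_k s 0 k *: lincomb B (row k E).
Proof.
rewrite /lincomb; under eq_bigr do rewrite mxE scaler_suml.
rewrite exchange_big; apply: eq_bigr => k _ /=; rewrite scaler_sumr.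
by apply: eq_bigr => j _; rewrite mxE scalerA.
Qed.

Lemma comm_lincomb y z : GRing.comm (lincomb B y) (lincomb B z).
Proof.
apply: commr_lin_sum => i; apply: commr_sym; apply: commr_lin_sum => j.
exact: cB.
Qed.

Lemma nilpotent_lincomb y : lincomb B y ^+ d = 0.
Proof. exact: nilpotent_sum. Qed.

Lemma texp_lincombD y z :
  texp (lincomb B (y + z)) = texp (lincomb B y) * texp (lincomb B z).
Proof.
rewrite lincombD texpD //; try exact: nilpotent_lincomb; exact: comm_lincomb.
Qed.

End LinearCombinations.

Lemma map_mx_exp (aR rR : pzRingType) (f : {rmorphism aR -> rR}) d (A : 'M[aR]_d) k :
  map_mx f (A ^+ k) = map_mx f A ^+ k.
Proof.
elim: k => [|k IH]; first by rewrite !expr0 map_mx1.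
by rewrite !exprS -!mulmxE map_mxM IH.
Qed.

Lemma map_mx_prod (aR rR : pzRingType) (f : {rmorphism aR -> rR}) d (I : Type)
    (A : I -> 'M[aR]_d) (w : seq I) :
  map_mx f (\prod_(i <- w) A i) = \prod_(i <- w) map_mx f (A i).
Proof.
elim: w => [|i w IH]; first by rewrite !big_nil map_mx1.
by rewrite !big_cons -IH -!mulmxE map_mxM.
Qed.

Lemma map_lincomb (F E : numFieldType) (f : {rmorphism F -> E}) n d
    (B : 'I_n -> 'M[F]_d) y :
  map_mx f (lincomb B y) = lincomb (fun j => map_mx f (B j)) (map_mx f y).
Proof.
by rewrite raddf_sum; apply: eq_bigr => j _; rewrite /= map_mxZ mxE.
Qed.

Lemma mxlim_lincomb (K : numFieldType) (I : Type) (F : set_system I)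
    (FF : ProperFilter F) n d (B : 'I_n -> 'M[K]_d) y l :
  mxlim F y l -> mxlim F (fun x => lincomb B (y x)) (lincomb B l).
Proof.
move=> yl; apply: mxlim_sum => j; apply: mxlimZ; first exact: yl.
exact: mxlim_cst.
Qed.

Arguments mxlim_lincomb {K I F FF n d} B {y l}.

Lemma texp_sq0 (F : numFieldType) d (X : 'M[F]_d) (v : 'cV[F]_d) :
  X *m (X *m v) = 0 -> texp X *m v = v + X *m v.
Proof.
move=> XXv; rewrite /texp mulmx_suml 2!big_ord_recl /= fact0 invr1 !scale1r.
rewrite expr0 expr1 mul1mx big1 ?addr0 // => i _.
rewrite /bump /= !add1n !exprSr -scalemxAl -!mulmxE -!mulmxA XXv.
by rewrite mulmx0 scaler0.
Qed.

Lemma ratr_is_real (F : numFieldType) (q : rat) : (ratr q : F) \is Num.real.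
Proof. by rewrite realE -[0](rmorph0 ratr) !ler_rat le_total. Qed.

(** The rows of the matrix on the right are the vectors [B j *m g], so the [y] with N(y) g = 0 form
    its left kernel, and linear algebra over the coordinates [y] applies. *)
Lemma lincomb_col (F : numFieldType) n d (B : 'I_n -> 'M[F]_d) y (g : 'cV[F]_d) :
  lincomb B y *m g = (y *m \matrix_(j, a) (B j *m g) a 0)^T.
Proof.
apply/colP => a; rewrite !mxE.
have -> : \sum_j lincomb B y a j * g j 0 = (lincomb B y *m g) a 0 by rewrite mxE.
rewrite mulmx_suml summxE; apply: eq_bigr => j _.
by rewrite -scalemxAl !mxE.
Qed.

Section ExponentialAction.
Variables (F : numFieldType) (n d : nat) (B : 'I_n -> 'M[F]_d).
Hypotheses (cB : forall i j, GRing.comm (B i) (B j)) (B0 : forall j, B j ^+ d = 0).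
Implicit Types (x y z : 'rV[F]_n) (g v : 'cV[F]_d).

Lemma texp_lincomb_comp x y g :
  texp (lincomb B x) *m (texp (lincomb B y) *m g) = texp (lincomb B (x + y)) *m g.
Proof. by rewrite texp_lincombD // mulmxA mulmxE. Qed.

Lemma texp_lincomb_solve x y g v :
  texp (lincomb B x) *m v = texp (lincomb B y) *m g ->
  v = texp (lincomb B (y - x)) *m g.
Proof.
move=> xvyg; rewrite addrC -texp_lincomb_comp -xvyg texp_lincomb_comp addNr.
by rewrite /lincomb big1 ?texp0 ?mul1mx // => j _; rewrite mxE scale0r.
Qed.

(** The exponential of N(y) fixes every vector killed by N(y). *)
Lemma texp_lincomb_fix x y g : lincomb B y *m g = 0 ->
  texp (lincomb B (x + y)) *m g = texp (lincomb B x) *m g.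
Proof.
move=> yg; rewrite -texp_lincomb_comp; congr (_ *m _).
by rewrite texp_sq0 yg ?mulmx0 ?addr0.
Qed.

End ExponentialAction.

(** * Convergence of exp(-i N(y)) h with h integral *)

Section Convergence.
Variables (K : numClosedFieldType) (I : Type) (F : set_system I).
Context {FF : ProperFilter F}.
Variables (n d : nat) (B : 'I_n -> 'M[rat]_d).
Hypotheses (cB : forall i j, GRing.comm (B i) (B j)) (B0 : forall j, B j ^+ d = 0).
Variables (h : I -> 'cV[int]_d) (s : I -> 'rV[K]_n).
Hypothesis s_real : forall x j, s x 0 j \is Num.real.

Local Notation rho := (map_mx (ratr : rat -> K)).
Local Notation hQ x := (map_mx intr (h x) : 'cV[rat]_d).
Let BK j := rho (B j).

Let cBK i j : GRing.comm (BK i) (BK j).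
Proof. by rewrite /GRing.comm -!mulmxE -!map_mxM /= !mulmxE cB. Qed.

Let BK0 j : BK j ^+ d = 0.
Proof. by rewrite -map_mx_exp B0 map_mx0. Qed.

(* Descending induction on the rational subspace spanned by the rows of E. *)
Lemma bounded_distance_to_kernel (E : 'M[rat]_n) (l : 'cV[K]_d) :
  mxlim F (fun x => texp (- 'i *: lincomb BK (s x *m rho E)) *m rho (hQ x)) l ->
  exists h0 E' (b : 'rV[K]_n), [/\ \forall x \near F, h x = h0,
    mxlim F (fun x => s x *m rho (E - E')) b &
    forall k, lincomb B (row k E') *m map_mx intr h0 = 0].
Proof.
move: l; have [r] := ubnP (\rank E); elim: r E => // r IH E; rewrite ltnS => rE l lim.
(* The [A k] are the values of N on the rows of [E]; they span its values on the whole row space. *)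
pose A k := lincomb B (row k E).
have cA i j : GRing.comm (A i) (A j) by apply: comm_lincomb.
pose word (w : seq 'I_n) := \prod_(i <- w) A i.
(* A product counts as killing [h] when it does so eventually along [F], since [h] varies.
   Minimality of [k] below provides the longest surviving product. *)
pose kills w := \forall x \near F, word w *m hQ x = 0.
pose Q k := `[< forall w, size w = k -> kills w >].
have exQ : exists k, Q k.
  exists (n * d).+1; apply/asboolP => w szw; apply: nearW => x.
  rewrite /word (word_nilpotent (d := d)) ?mul0mx ?szw //.
  by move=> i; apply: nilpotent_lincomb.
have [k /asboolP Qk mink] := ex_minnP exQ.
have NsE x : lincomb BK (s x *m rho E) = \sum_i s x 0 i *: rho (A i).
  rewrite lincomb_mul; apply: eq_bigr => i _; congr (_ *: _).
  by rewrite map_lincomb map_row.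
have NA x (v : 'cV_d) : (forall i, A i *m v = 0) ->
    lincomb BK (s x *m rho E) *m rho v = 0.
  move=> Av; rewrite NsE mulmx_suml big1 // => i _.
  by rewrite -scalemxAl -map_mxM Av map_mx0 scaler0.
(* Here every [A i] eventually kills [h], so the exponential acts trivially, [h] itself converges,
   and [E] already serves as [E'] with [b = 0]. *)
have [k1|] := leqP k 1.
  have kill1 : \forall x \near F, forall i, A i *m hQ x = 0.
    apply: filter_forall => i; move: k k1 Qk {mink} => [|[|//]] _ Qk.
      have := Qk [::] erefl; apply: filterS => x.
      by rewrite /word big_nil mul1mx => ->; rewrite mulmx0.
    by have := Qk [:: i] erefl; apply: filterS => x; rewrite /word big_seq1.
  have hl : mxlim F (fun x => rho (1%:M *m hQ x)) l.
    apply: (mxlim_near _ lim); apply: filterS kill1 => x kx.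
    by rewrite texp_sq0 -!scalemxAl NA ?scaler0 ?mulmx0 ?scaler0 ?addr0 ?mul1mx.
  have [g hg] := rat_image_eventually_cst hl.
  have [x0 [hx0 kx0]] := filter_ex (filterI hg kill1).
  exists (h x0), E, 0; split=> //.
    apply: filterS hg => x; rewrite -hx0 !mul1mx => /matrixP hx.
    apply/matrixP => a b; have := hx a b; rewrite !mxE.
    exact: intr_inj.
  by rewrite subrr map_mx0; under eq_fun do rewrite mulmx0; apply: mxlim_cst.
case: k Qk mink => [//|[//|k]] Qk mink _.
(* The least killing length is now [k.+2], so some word of length [k.+1] survives. Its tail [q] is
   such that any two further factors kill [word q *m hQ x]. *)
have [i [q [szq Nq]]] : exists i q, size q = k /\ ~ kills (i :: q).
  apply: contrapT => noq; have /mink : Q k.+1; last by rewrite ltnn.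
  apply/asboolP => -[//|i q] [szq]; apply: contrapT => Nk.
  by apply: noq; exists i, q.
have kill2 : \forall x \near F, forall i j, A i *m (A j *m (word q *m hQ x)) = 0.
  apply: filter_forall => i1; apply: filter_forall => j1.
  have := Qk [:: i1, j1 & q]; rewrite /= szq => /(_ erefl).
  by apply: filterS => x; rewrite /word !big_cons -!mulmxE -!mulmxA.
pose u x := rho (word q *m hQ x).
pose v x := lincomb BK (s x *m rho E) *m u x.
(* [word q] commutes with the exponential, and by [kill2] only the terms of degree at most one
   survive on [u x]. *)
have uvl : mxlim F (fun x => u x - 'i *: v x) (rho (word q) *m l).
  apply: (mxlim_near _ (mxlimM (mxlim_cst _) lim)).
  apply: filterS kill2 => x kx.
  have cwt : GRing.comm (rho (word q)) (texp (- 'i *: lincomb BK (s x *m rho E))).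
    apply: commr_lin_sum => a; apply: commrX; apply: commr_scale.
    apply: commr_sym; rewrite /word.
    rewrite map_mx_prod.
    apply: commr_prod => a0 _; rewrite map_lincomb; exact: (comm_lincomb cBK).
  rewrite mulmxA [X in X *m _]cwt -mulmxE -mulmxA -map_mxM -/(u x) texp_sq0.
    by rewrite -scalemxAl scaleNr.
  have NNu : lincomb BK (s x *m rho E) *m (lincomb BK (s x *m rho E) *m u x) = 0.
    have -> : lincomb BK (s x *m rho E) *m u x =
        \sum_a s x 0 a *: rho (A a *m (word q *m hQ x)).
      rewrite NsE mulmx_suml; apply: eq_bigr => a _.
      by rewrite -scalemxAl -map_mxM.
    by rewrite mulmx_sumr big1 // => a _; rewrite -scalemxAr NA ?scaler0.
  by rewrite -!scalemxAl -!scalemxAr NNu !scaler0.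
have [lu [lv [ul vl]]] : exists lu lv, mxlim F u lu /\ mxlim F v lv.
  have ur x a b : u x a b \is Num.real by rewrite mxE; apply: ratr_is_real.
  apply: mxlim_real_imag uvl => // x a b.
  rewrite /v NsE mulmx_suml summxE; apply: rpred_sum => c _.
  by rewrite -scalemxAl -map_mxM mxE rpredM // mxE; apply: ratr_is_real.
have [g ug] := rat_image_eventually_cst ul.
pose L := \matrix_(j, a) (B j *m g) a 0.
have rhoL : rho L = \matrix_(j, a) (BK j *m rho g) a 0.
  by apply/matrixP => j a; rewrite [RHS]mxE -map_mxM !mxE.
have sL : mxlim F (fun x => s x *m rho (E *m L)) lv^T.
  suff /= vTl : mxlim F (fun x => (v x)^T) lv^T.
    apply: (mxlim_near _ vTl); apply: filterS ug => x ux.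
    by rewrite /v /u ux lincomb_col trmxK -rhoL -mulmxA map_mxM.
  by move=> a b; rewrite mxE; under eq_fun do rewrite mxE; apply: vl.
(* [X] projects onto the left kernel of [L'], so the rows of [X *m E] span the vectors y in the row
   space of [E] with N(y) g = 0. *)
pose L' := E *m L; pose X := 1%:M - L' *m pinvmx L'.
have XL' : X *m L' = 0 by rewrite mulmxBl mul1mx mulmxKpV // subrr.
(* Were the rank unchanged, [E] would factor through [X *m E], whence [L' = 0]: every [A i] would
   kill [g], against the choice of [i :: q]. *)
have rX : (\rank (X *m E) < r)%N.
  apply: leq_trans rE; rewrite ltn_neqAle mxrankS ?submxMl // andbT.
  apply: contra_notN Nq => /eqP eqr.
  have : (E <= X *m E)%MS.
    by rewrite -(mxrank_leqif_sup (submxMl X E)).2 eqr.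
  case/submxP => Y EY.
  have L'0 : L' = 0 by rewrite /L' {1}EY -!mulmxA -/L' XL' mulmx0.
  apply: filterS ug => x ux.
  rewrite /word big_cons -/(word q) -mulmxE -mulmxA ux lincomb_col.
  by rewrite -/L -row_mul -/L' L'0 linear0 trmx0.
(* The part of [s] dropped in passing from [E] to [X *m E] is a fixed linear image of the convergent
   [s x *m rho L']. *)
have bl : mxlim F (fun x => s x *m rho (E - X *m E)) (lv^T *m rho (pinvmx L' *m E)).
  apply: (mxlim_near _ (mxlimM sL (mxlim_cst _))); apply: nearW => x.
  rewrite -mulmxA -map_mxM; congr (_ *m rho _).
  by rewrite /X mulmxBl mul1mx opprB addrC subrK mulmxA.
(* The convergent part is absorbed into the limit by the inverse exponential, which leaves the
   induction hypothesis for [X *m E]. *)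
have [|h0 [E' [b [hh0 bb kE']]]] :=
  IH _ rX (texp ('i *: lincomb BK (lv^T *m rho (pinvmx L' *m E))) *m l).
  have tl : mxlim F (fun x => texp ('i *: lincomb BK (s x *m rho (E - X *m E))))
      (texp ('i *: lincomb BK (lv^T *m rho (pinvmx L' *m E)))).
    by apply: mxlim_texp; apply: mxlimZl; apply: mxlim_lincomb.
  apply: (mxlim_near _ (mxlimM tl lim)); apply: nearW => x.
  rewrite mulmxA -!lincombZ mulmxE -texp_lincombD //; congr (texp (lincomb _ _) *m _).
  by rewrite map_mxB mulmxBr scalerBr !scaleNr addrAC subrr add0r.
exists h0, E', (lv^T *m rho (pinvmx L' *m E) + b); split=> //.
apply: (mxlim_near _ (mxlimD bl bb)); apply: nearW => x.
by rewrite -mulmxDr -map_mxD /= addrA subrK.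
Qed.

End Convergence.

(** * Exponentials preserving the lattice, and logarithms of the monodromy *)

Lemma map_texp (E F : numFieldType) (f : {rmorphism E -> F}) d (A : 'M[E]_d) :
  map_mx f (texp A) = texp (map_mx f A).
Proof.
rewrite raddf_sum; apply: eq_bigr => k _.
by rewrite /= map_mxZ map_mx_exp fmorphV rmorph_nat.
Qed.

(* With D a multiple of (d + 2)!, the factorials in the denominators of the
   exponential series cancel. *)
Lemma texp_lattice n d (B : 'I_n -> 'M[rat]_d) :
  exists D : nat, (0 < D)%N /\ forall k : 'rV[int]_n,
    exists H : 'M[int]_d, texp (lincomb B (- D%:R *: map_mx intr k)) = map_mx intr H.
Proof.
have [D0 /fin_all_exists[B' DB]] := fin_all_exists (fun j => rat_mx_clear (B j)).
have D0_gt0 j : (0 < D0 j)%N by have [] := DB j.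
(* [D1] clears the denominators of all the [B j] at once. The i-th term of the exponential then
   carries [f ^ i], a multiple of [i!] for every i below [d.+2]. *)
pose D1 := (\prod_j D0 j)%N; pose f := (d.+2)`!.
exists (D1 * f)%N; split.
  by rewrite muln_gt0 fact_gt0 andbT prodn_gt0.
move=> k.
pose M := \sum_j (k 0 j *+ (D1 %/ D0 j)) *: B' j.
have -> : lincomb B (- (D1 * f)%:R *: map_mx intr k) = (- f%:R : rat) *: map_mx intr M.
  rewrite lincombZ natrM mulrC -mulNr -scalerA; congr (_ *: _).
  rewrite [map_mx _ M]raddf_sum scaler_sumr; apply: eq_bigr => j _ /=.
  rewrite map_mxZ -(DB j).2 !scalerA mxE; congr (_ *: _).
  have dvd : (D0 j %| D1)%N by rewrite /D1 (bigD1 j) //= dvdn_mulr.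
  by rewrite -{1}(divnK dvd) natrM rmorphMn /= -[(k 0 j)%:~R *+ _]mulr_natl mulrAC.
exists (\sum_(i < d.+2) ((-1) ^+ i * (f ^ i %/ i`!)%N%:Z) *: M ^+ i).
rewrite [RHS]raddf_sum; apply: eq_bigr => i _ /=.
rewrite map_mxZ map_mx_exp exprZ_mx scalerA; congr (_ *: _).
rewrite rmorphM rmorphXn /= rmorphN1 -pmulrn.
have dvd : (i`! %| f ^ i)%N.
  case: i => -[|i] /= id; first by rewrite fact0 dvd1n.
  by rewrite expnS dvdn_mulr // /f -(bin_fact (ltnW id)) dvdn_mull // dvdn_mulr.
rewrite -mulN1r exprMn mulrCA; congr (_ * _).
rewrite -natrX -{1}(divnK dvd) natrM mulrC mulfK // pnatr_eq0 -lt0n.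
Qed.

Section Monodromy.
Variables (F : numFieldType) (n d : nat) (T : 'I_n -> 'M[int]_d).
Hypotheses (T_comm : forall i j, T i *m T j = T j *m T i)
  (T_unip : forall j, unipotent (T j)).

Lemma comm_nlog i j :
  GRing.comm (nlog (map_mx intr (T i) : 'M[F]_d)) (nlog (map_mx intr (T j))).
Proof.
apply: commr_sum => a _; apply: commr_scale; apply: commrX.
apply: commr_sym; apply: commr_sum => b _; apply: commr_scale; apply: commrX.
apply: commr_sym; apply: commrB; first exact: commr1.
apply: commr_sym; apply: commrB; first exact: commr1.
by rewrite /GRing.comm -!mulmxE -!map_mxM /= T_comm.
Qed.

(** The logarithm is a combination of the positive powers of [U], which are nilpotent and
    commute. *)
Lemma nilpotent_nlog j : nlog (map_mx intr (T j) : 'M[F]_d) ^+ d = 0.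
Proof.
have [k Tk] := T_unip j; set U := 1%:M - (map_mx intr (T j) : 'M[F]_d).
have Ud0 : U ^+ d = 0.
  apply: (@nilpotent_exp_dim _ _ _ k).
  have -> : U = map_mx intr (1%:M - T j) by rewrite map_mxB map_mx1.
  by rewrite -map_mx_exp Tk map_mx0.
have -> : nlog (map_mx intr (T j)) = \sum_(m < d) m.+1%:R^-1 *: U ^+ m.+1.
  by rewrite /nlog big_add1 /= big_mkord.
apply: nilpotent_sum.
  by move=> a b; apply: commrX; apply: commr_sym; apply: commrX.
move=> m; rewrite exprAC Ud0 exprS mul0r //.
Qed.

End Monodromy.

Lemma map_nlog (E F : numFieldType) (f : {rmorphism E -> F}) d (A : 'M[E]_d) :
  map_mx f (nlog A) = nlog (map_mx f A).
Proof.
rewrite /nlog raddf_sum; apply: eq_bigr => k _.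
by rewrite /= map_mxZ map_mx_exp fmorphV rmorph_nat map_mxB map_mx1.
Qed.

Lemma mx_hausdorff (K : numFieldType) m n : hausdorff_space 'M[K]_(m, n).
Proof.
move=> p q pq; apply/matrixP => i j; apply: (@norm_hausdorff K K^o) => U V pU qV.
pose c (M : 'M[K]_(m, n)) := M i j; have := pq (c @^-1` U) (c @^-1` V).
by case=> [||M [? ?]]; [exact: coord_continuous..|exists (M i j)].
Qed.

Section Statement.
Variable R : realType.
Local Notation C := (C R).

(** The partial sums of the series are constant from index [d] on. *)
Lemma mexpE d (A : 'M[C]_d) : A ^+ d = 0 -> mexp A = texp A.
Proof.
move=> Ad0; apply: (@lim_near_cst _ (@mx_hausdorff C d d)); exists d => //= K dK.
by rewrite /series /= texp_widen.
Qed.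

Variables (n d : nat) (T : 'I_n -> 'M[int]_d).
Hypotheses (T_comm : forall i j, T i *m T j = T j *m T i)
  (T_unip : forall j, unipotent (T j)).

(** The logarithm of an integral matrix is computed over the rationals, where the argument on
    subspaces and denominators takes place. *)
Lemma monodromy_rat j :
  monodromy_N R T j = map_mx ratr (nlog (map_mx intr (T j)) : 'M[rat]_d).
Proof.
rewrite map_nlog /monodromy_N; congr nlog; apply/matrixP => a b.
by rewrite !mxE /= ratr_int.
Qed.

Lemma expNE w h : expN T w h = texp (lincomb (monodromy_N R T) (- w)) *m vecC R h.
Proof.
rewrite /expN -/(lincomb _ _) -lincombN mexpE //.
apply: nilpotent_lincomb => [i j|j]; [exact: comm_nlog|exact: nilpotent_nlog].
Qed.

End Statement.

(** * The covering map and the arcs *)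

Section CoveringMap.
Variable R : realType.
Local Notation C := (C R).
Implicit Types z t : C.

Lemma e2pii_ReIm z : e2pii z =
  ((expR (- (2 * pi * complex.Im z)) * cos (2 * pi * complex.Re z))
  +i* (expR (- (2 * pi * complex.Im z)) * sin (2 * pi * complex.Re z)))%C.
Proof.
rewrite /e2pii; case: z => x y.
suff -> : 2 * (pi : R)%:C%C * 'i * (x +i* y)%C =
  (- (2 * pi * y) +i* (2 * pi * x))%C :> C by [].
by apply/eqP; rewrite eq_complex /=; apply/andP; split; apply/eqP; ring.
Qed.

Lemma e2piiD z1 z2 : e2pii (z1 + z2) = e2pii z1 * e2pii z2.
Proof.
rewrite !e2pii_ReIm; case: z1 => a b; case: z2 => c d /=.
rewrite !mulrDr opprD expRD cosD sinD.
by apply/eqP; rewrite eq_complex /=; apply/andP; split; apply/eqP; ring.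
Qed.

Lemma e2piiMn z k : e2pii (k%:R * z) = e2pii z ^+ k.
Proof.
elim: k => [|k IH].
  rewrite mul0r expr0 e2pii_ReIm /= !mulr0 oppr0 expR0 cos0 sin0 mulr1 mulr0.
  by [].
by rewrite -natr1 mulrDl mul1r e2piiD IH exprSr.
Qed.

Lemma norm_e2pii z : `|e2pii z| = (expR (- (2 * pi * complex.Im z)))%:C%C.
Proof.
rewrite e2pii_ReIm normc_def /= !exprMn -mulrDr cos2Dsin2 mulr1 sqrtr_sqr.
by rewrite ger0_norm // expR_ge0.
Qed.

Lemma e2pii_surj t : t != 0 -> exists z, e2pii z = t.
Proof.
case: t => a b; rewrite eq_complex /= => ab0.
pose r := Num.sqrt (a ^+ 2 + b ^+ 2).
have r2 : r ^+ 2 = a ^+ 2 + b ^+ 2 by rewrite sqr_sqrtr // addr_ge0 // sqr_ge0.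
have r_gt0 : 0 < r.
  rewrite sqrtr_gt0 lt0r addr_ge0 ?sqr_ge0 // andbT paddr_eq0 ?sqr_ge0 //.
  by rewrite !sqrf_eq0.
have cs1 : (a / r) ^+ 2 + (b / r) ^+ 2 = 1.
  by rewrite !exprMn -mulrDl -r2 -exprMn mulfV ?expr1n // gt_eqF.
have a1 : -1 <= a / r <= 1.
  rewrite -ler_norml -(@ler_pXn2r _ 2) ?nnegrE // expr1n real_normK ?num_real //.
  by rewrite -cs1 lerDl sqr_ge0.
(* The values of [acos] have nonnegative sine, so the angle is negated when [b / r] is negative. *)
have [th [cth sth]] : exists th, cos th = a / r /\ sin th = b / r.
  have sth : sin (acos (a / r)) = `|b / r|.
    by rewrite sin_acos // -cs1 addrAC subrr add0r sqrtr_sqr.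
  have [b0|b0] := leP 0 (b / r).
    by exists (acos (a / r)); rewrite acosK ?sth ?ger0_norm // in_itv.
  exists (- acos (a / r)); rewrite cosN sinN acosK ?in_itv //.
  by rewrite sth ltr0_norm // opprK.
exists ((th / (2 * pi)) +i* (- ln r / (2 * pi)))%C.
have pi2 : 2 * pi != 0 :> R by rewrite mulf_neq0 ?pnatr_eq0 // gt_eqF // pi_gt0.
rewrite e2pii_ReIm /= ![2 * pi * _]mulrC !divfK // opprK lnK ?posrE // cth sth.
by rewrite ![r * _]mulrC !divfK // gt_eqF.
Qed.

End CoveringMap.

Section Arcs.
Variables (R : realType) (n d : nat) (T : 'I_n -> 'M[int]_d).
Hypotheses (T_comm : forall i j, T i *m T j = T j *m T i)
  (T_unip : forall j, unipotent (T j)).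
Local Notation C := (C R).

Lemma embedding_image_sub_disk_bundle : @embedding_image R n d T `<=` @disk_bundle R n d.
Proof.
move=> _ [[z h] [/= zU _] <-]; split=> // j; rewrite /= mxE norm_e2pii.
by rewrite (ltcR _ 1) -expR0 ltr_expR oppr_lt0 !mulr_gt0 ?pi_gt0 ?zU.
Qed.

Lemma Im_gt0_of_norm_lt1 (z : C) : `|e2pii z| < 1 -> 0 < complex.Im z.
Proof.
rewrite norm_e2pii (ltcR _ 1) -expR0 ltr_expR oppr_lt0 pmulr_rgt0 //.
by rewrite mulr_gt0 // pi_gt0.
Qed.

(** The relation says that N(a) kills [h], so the exponential of any multiple of N(a) fixes [h].
    This keeps the second component constant along the arc. *)
Lemma expN_shift a (h : 'cV[int]_d) w (tau : C) :
  positive_relation R T a h ->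
  expN T (w + tau *: \row_j (a j)%:R) h = expN T w h.
Proof.
case=> _ rel; rewrite !(expNE T_comm T_unip). rewrite opprD texp_lincombD; last 2 first.
- by move=> i j; exact: comm_nlog.
- by move=> j; exact: nilpotent_nlog.
have Nah : lincomb (monodromy_N R T) (- (tau *: \row_j (a j)%:R)) *m vecC R h = 0.
  rewrite -scaleNr lincombZ -scalemxAl mulmx_suml.
  rewrite [X in _ *: X](_ : _ = 0) ?scaler0 // -[RHS]rel; apply: eq_bigr => j _.
  by rewrite mxE scalemxAl.
by rewrite -mulmxE -mulmxA [X in _ *m X]texp_sq0 Nah ?mulmx0 ?addr0.
Qed.

(** Writing [t] as [e2pii tau], the point of the arc is the image of [w + tau *: a] and [h].
    Membership in the polydisk forces the imaginary parts of these coordinates to be positive. *)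
Lemma limit_arc_image a (h : 'cV[int]_d) w (t : C) :
  positive_relation R T a h -> t != 0 -> disk_bundle (limit_arc T a w h t) ->
  embedding_image T (limit_arc T a w h t).
Proof.
move=> rel /e2pii_surj[tau <-] [disk _].
have arcE : \row_j e2pii ((w + tau *: \row_j (a j)%:R) 0 j) =
    \row_j (e2pii tau ^+ a j * e2pii (w 0 j)).
  by apply/rowP => j; rewrite !mxE e2piiD mulrC [tau * _]mulrC e2piiMn.
exists (w + tau *: \row_j (a j)%:R, h).
  split=> // j; apply: Im_gt0_of_norm_lt1.
  by have := disk j; rewrite /limit_arc /= -arcE mxE.
by rewrite /embedding /= expN_shift // arcE.
Qed.

Lemma limit_arc_disk (a : 'I_n -> nat) (h : 'cV[int]_d) w :
  (forall j, (0 < a j)%N) ->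
  exists eps : R, 0 < eps /\
    forall t : C, `|t| < eps%:C%C -> disk_bundle (limit_arc T a w h t).
Proof.
move=> a0; pose c j := expR (- (2 * pi * complex.Im (w 0 j : C))).
have c0 j : 0 <= c j by apply: expR_ge0.
(* [M] bounds every [|e2pii (w 0 j)|]. The summand 1 keeps the radius [M^-1] at most 1, so that
   [|t| ^+ a j] is at most [|t|], as [a j] is positive. *)
pose M := 1 + \sum_j c j.
have M1 : 1 <= M by rewrite lerDl sumr_ge0.
have M0 : 0 < M by apply: lt_le_trans M1.
have cM j : c j <= M.
  by rewrite /M (bigD1 j) //= addrCA lerDl addr_ge0 // sumr_ge0.
exists M^-1; split=> [|t tM]; first by rewrite invr_gt0.
split=> // j; rewrite /= mxE normrM normrX norm_e2pii -/(c j).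
have [r tr] : exists r : R, `|t| = r%:C%C.
  by rewrite normc_def; eexists.
have r0 : 0 <= r by rewrite -(lecR 0) -tr normr_ge0.
move: tM; rewrite tr ltcR => rM.
rewrite -(rmorphXn (real_complex R)) -(rmorphM (real_complex R)) /= (ltcR _ 1).
have r1 : r <= 1 by rewrite (le_trans (ltW rM)) // invf_le1.
apply: (@le_lt_trans _ _ (r * M)).
  apply: ler_pM => //; first exact: exprn_ge0.
  by rewrite -(prednK (a0 j)) exprS ler_piMr // exprn_ile1.
by rewrite -(mulVf (lt0r_neq0 M0)) ltr_pM2r.
Qed.

End Arcs.

(** * Points of the closure over the origin *)

(** At a point of [A] the neighbourhoods in [subspace A] are governed by traces on [A] of ambient
    ones, and [E] lies in [A], so ambient neighbourhoods suffice to test the closure. *)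
Lemma closure_subspaceP (X : topologicalType) (A E : set X) (p : X) : A p -> E `<=` A ->
  closure (E : set (subspace A)) p <->
  forall U : set X, nbhs p U -> exists2 q, E q & U q.
Proof.
move=> Ap EA; split=> [clE U pU|clE V pV].
  have : nbhs (p : subspace A) U.
    rewrite -[nbhs _]/(nbhs_subspace _) -nbhs_subspace_in //.
    by apply: filterS pU => q Uq _.
  by move=> /clE[q [Eq Uq]]; exists q.
move: pV; rewrite -[nbhs _]/(nbhs_subspace _) -nbhs_subspace_in // => /clE[q Eq Vq].
by exists q; split=> //; apply: Vq; apply: EA.
Qed.

Lemma cvg_exprn (K : numFieldType) (I : Type) (F : set_system I) (FF : Filter F)
    (f : I -> K) (l : K) k :
  f x @[x --> F] --> l -> f x ^+ k @[x --> F] --> l ^+ k.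
Proof.
move=> fl; elim: k => [|k IH]; first exact: cvg_cst.
by rewrite exprS; under eq_fun do rewrite exprS; apply: cvgM.
Qed.

(** Compactness of the segment gives a cluster point, and an ultrafilter converges to each of its
    cluster points. *)
Lemma ultra_segment_cvg (R : realType) (I : Type) (G : set_system I)
    (GU : UltraFilter G) (f : I -> R) a b :
  (forall x, a <= f x <= b) -> exists c : R, f x @[x --> G] --> c.
Proof.
move=> fab; have GP : ProperFilter G by exact: ultra_proper.
have [|c [_ cc]] := @segment_compact R a b (fmap f G) _.
  by apply: nearW => x; rewrite /= in_itv /=.
exists c => U cU; have [//|GnU] := in_ultra_setVsetC (f @^-1` U) GU.
have [x [nUx Ux]] := cc (~` U) U GnU cU.
by have := nUx Ux.
Qed.

(** * Positive integral vectors in rational subspaces, and limit points reached by arcs *)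

Section Positivity.
Variables (R : realType) (n : nat).

(** Scale [y] by a large [m] and round down. Rounding lowers coordinate j of the product by at most
    the absolute column sum [S j], and [m] is chosen to make that coordinate exceed [S j]. *)
Lemma rational_positive_vector (E : 'M[rat]_n) (y : 'rV[R]_n) :
  (forall j, 0 < (y *m map_mx ratr E) 0 j) ->
  exists s : 'rV[int]_n, forall j, 0 < (map_mx intr s *m E) 0 j.
Proof.
move=> yE; pose S j := \sum_k `|ratr (E k j) : R|.
have S0 j : 0 <= S j by apply: sumr_ge0.
pose m := (\sum_j Num.bound (S j / (y *m map_mx ratr E) 0%R j))%N.
have Sm j : S j < m%:R * (y *m map_mx ratr E) 0 j.
  rewrite -ltr_pdivrMr //.
  apply: lt_le_trans (archi_boundP (divr_ge0 (S0 j) (ltW (yE j)))) _.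
  by rewrite ler_nat /m (bigD1 j) //= leq_addr.
exists (\row_k Num.floor (m%:R * y 0 k)) => j.
rewrite -(ltr_rat R) rmorph0.
have -> : ratr ((map_mx intr (\row_k Num.floor (m%:R * y 0 k)) *m E) 0 j) =
    m%:R * (y *m map_mx ratr E) 0 j -
    \sum_k (m%:R * y 0 k - (Num.floor (m%:R * y 0 k))%:~R) * ratr (E k j).
  rewrite !mxE rmorph_sum mulr_sumr -sumrB; apply: eq_bigr => k _ /=.
  by rewrite !mxE rmorphM /= ratr_int mulrBl opprB addrC mulrA subrK.
rewrite subr_gt0 (le_lt_trans _ (Sm j)) //; apply: ler_sum => k _.
apply: (le_trans (ler_norm _)); rewrite normrM ler_piMl //.
have /andP[fl fu] := floor_itv (m%:R * y 0 k).
rewrite ger0_norm ?subr_ge0 // lerBlDl ltW //.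
by rewrite intrD in fu.
Qed.

End Positivity.

Section Closure.
Variables (R : realType) (n d : nat) (T : 'I_n -> 'M[int]_d).
Hypotheses (T_comm : forall i j, T i *m T j = T j *m T i)
  (T_unip : forall j, unipotent (T j)).
Local Notation C := (C R).
Let B j : 'M[rat]_d := nlog (map_mx intr (T j)).

(** A positive vector in the rational row space of [E], cleared of denominators, gives the integers
    [a]; N kills [h] along the whole row space. *)
Lemma positive_relation_ex (E : 'M[rat]_n) (y : 'rV[R]_n) (h : 'cV[int]_d) :
  (forall j, 0 < (y *m map_mx ratr E) 0 j) ->
  (forall k, lincomb B (row k E) *m map_mx intr h = 0) ->
  exists a, positive_relation R T a h.
Proof.
move=> /rational_positive_vector[s sE] Eh.
have [D [c [D0 Dc]]] := rat_mx_clear (map_mx intr s *m E).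
have c0 j : 0 < c 0 j.
  have : 0 < (D%:R *: (map_mx intr s *m E)) 0 j by rewrite mxE mulr_gt0 ?ltr0n.
  by rewrite Dc mxE ltr0z.
exists (fun j => `|c 0%R j|%N); split=> [j|]; first by rewrite absz_gt0 gt_eqF.
have : lincomb B (map_mx intr c) *m map_mx intr h = 0.
  rewrite -Dc lincombZ -scalemxAl lincomb_mul mulmx_suml big1 ?scaler0 // => k _.
  by rewrite -scalemxAl Eh scaler0.
move=> /(congr1 (map_mx (ratr : rat -> C))).
rewrite map_mxM map_mx0 /lincomb raddf_sum mulmx_suml => rel.
rewrite -[RHS]rel; apply: eq_bigr => j _ /=.
rewrite map_mxZ -scalemxAl mxE /= ratr_int monodromy_rat natr_absz gtr0_norm //.
congr (_ *: (_ *m _)); apply/matrixP => a b.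
by rewrite !mxE ratr_int.
Qed.

(** The arc converges to the point as t tends to 0, and its points with small nonzero t lie in the
    image. *)
Lemma arc_point_in_closure a (h : 'cV[int]_d) w :
  positive_relation R T a h ->
  embedding_closure T ((0, expN T w h) : 'rV[C]_n * 'cV[C]_d).
Proof.
move=> rel; have [a0 _] := rel.
have p0 : @disk_bundle R n d (0, expN T w h).
  by split=> // j; rewrite /= mxE normr0.
apply/(closure_subspaceP p0 (@embedding_image_sub_disk_bundle _ _ _ T)) => U.
case=> -[/= V W] [[P P0 PV] hW] VWU.
have [eps [eps0 epsP]] := limit_arc_disk T h w a0.
have tP : \forall t \near (0 : C), forall j, P 0 j (t ^+ a j * e2pii (w 0 j)).
  have FF : Filter (nbhs (0 : C)) by apply: nbhs_filter.
  apply: (@filter_forall C 'I_n (fun j t => P 0 j (t ^+ a j * e2pii (w 0 j)))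
    (nbhs (0 : C)) FF) => j.
  have a00 : 0 ^+ a j * e2pii (w 0 j) = 0 :> C by rewrite expr0n gtn_eqF ?a0 // mul0r.
  have tl := @cvgM C C (nbhs (0 : C)) FF (fun t => t ^+ a j) (fun=> e2pii (w 0 j)) _ _
    (@cvg_exprn C C (nbhs (0 : C)) FF id 0 (a j) cvg_id) (@cvg_cst _ _ _ _ FF).
  rewrite a00 in tl.
  by apply: tl; have := P0 0 j; rewrite mxE.
have teps : \forall t \near (0 : C), `|t| < eps%:C%C.
  by apply: nbhs0_lt; rewrite (ltcR 0).
have [t [[tP' teps'] t0]] := filter_ex (filterI
  (nbhs_dnbhs (filterI tP teps)) (nbhs_dnbhs_neq (0 : C))).
exists (limit_arc T a w h t).
  by apply: limit_arc_image => //; apply: epsP.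
apply: VWU; split=> /=; last exact: nbhs_singleton.
by apply: PV => i j; rewrite mxE ord1.
Qed.

End Closure.

Lemma cvg_real_complex (R : realType) (I : Type) (F : set_system I) (FF : Filter F)
    (f : I -> R) (l : R) :
  f x @[x --> F] --> l -> ((f x)%:C%C : C R) @[x --> F] --> (l%:C%C : C R).
Proof.
move=> /cvgrPdist_lt fl; apply/cvgrPdist_lt => -[e e'] /=.
rewrite ltcE /= => /andP[/eqP -> e0]; apply: filterS (fl e e0) => x.
by rewrite -(rmorphB (real_complex R)) normc_def /= expr0n addr0 sqrtr_sqr ltcR.
Qed.

(** * From a point of the closure to a positive relation *)

Section Forward.
Variables (R : realType) (n d : nat) (T : 'I_n -> 'M[int]_d).
Hypotheses (T_comm : forall i j, T i *m T j = T j *m T i)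
  (T_unip : forall j, unipotent (T j)).
Local Notation C := (C R).
Local Notation pt := ('rV[C]_n * 'cV[int]_d)%type.
Let B j : 'M[rat]_d := nlog (map_mx intr (T j)).
Let cB i j : GRing.comm (B i) (B j). Proof. exact: comm_nlog. Qed.
Let B0 j : B j ^+ d = 0. Proof. exact: nilpotent_nlog. Qed.
Let N := monodromy_N R T.
Let cN i j : GRing.comm (N i) (N j). Proof. exact: comm_nlog. Qed.
Let N0 j : N j ^+ d = 0. Proof. exact: nilpotent_nlog. Qed.

(** The preimages under the embedding of the neighbourhoods of [p] generate a filter, proper because
    [p] is in the closure; [G] is an ultrafilter refining it. *)
Lemma closure_ultrafilter (p : 'rV[C]_n * 'cV[C]_d) :
  disk_bundle p -> p.1 = 0 -> embedding_closure T p ->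
  exists G : set_system pt, [/\ UltraFilter G,
    forall j, (fun zh : pt => e2pii (zh.1 0 j)) @ G --> (0 : C) &
    mxlim G (fun zh : pt => expN T zh.1 zh.2) p.2].
Proof.
move=> pA p10 /(closure_subspaceP pA (@embedding_image_sub_disk_bundle _ _ _ T)) clp.
pose G0 : set_system pt := filter_from (nbhs p) (fun U => [set zh | U (embedding T zh)]).
have G0F : ProperFilter G0.
  apply: filter_from_proper.
    apply: filter_from_filter; first by exists setT; apply: filterT.
    by move=> U V pU pV; exists (U `&` V) => //; apply: filterI.
  by move=> U /clp[_ [zh _ <-] Uzh]; exists zh.
have [G [GU G0G]] := ultraFilterLemma G0F.
exists G; split=> //.
  move=> j V V0; apply: G0G.
  exists [set q : 'rV[C]_n * 'cV[C]_d | V (q.1 0 j)]; last by move=> zh /=; rewrite mxE.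
  exists ([set q1 : 'rV[C]_n | V (q1 0 j)], setT); last by case=> a b [].
  split; last exact: filterT.
  by apply: (@coord_continuous C); rewrite /= p10 mxE.
move=> i j V V0; apply: G0G.
exists [set q : 'rV[C]_n * 'cV[C]_d | V (q.2 i j)]; last by move=> zh.
exists (setT, [set q2 : 'cV[C]_d | V (q2 i j)]); last by case=> a b [].
split; first exact: filterT.
by apply: (@coord_continuous C).
Qed.

Lemma Im_eventually_gt (G : set_system pt) (GF : Filter G) j (M : R) :
  (fun zh : pt => e2pii (zh.1 0 j)) @ G --> (0 : C) ->
  \forall zh \near G, M < complex.Im ((zh : pt).1 0 j : C).
Proof.
move=> /cvgrPdist_lt /(_ (expR (- (2 * pi * M)))%:C%C).
rewrite (ltcR 0) expR_gt0 => /(_ isT); apply: filterS => zh.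
rewrite sub0r normrN norm_e2pii ltcR ltr_expR ltrN2 ltr_pM2l //.
by rewrite mulr_gt0 // pi_gt0.
Qed.

Lemma closure_point (p : 'rV[C]_n * 'cV[C]_d) :
  disk_bundle p -> p.1 = 0 -> embedding_closure T p ->
  exists (h : 'cV[int]_d) (a : 'I_n -> nat) (w : 'rV[C]_n),
    positive_relation R T a h /\ p = (0, expN T w h).
Proof.
move=> pA p10 /(closure_ultrafilter pA p10)[G [GU lim1 lim2]].
have GP : ProperFilter G by exact: ultra_proper.
have [D [D0 /choice[H HE]]] := texp_lattice B.
(* The real part of each z_j is split as [D] times an integer [k] plus [D] times a fraction [fr] in
   the unit interval, which converges along the ultrafilter. *)
pose x (zh : pt) j := complex.Re (zh.1 0 j : C) / D%:R.
pose k (zh : pt) : 'rV[int]_n := \row_j Num.floor (x zh j).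
pose fr (zh : pt) j := x zh j - (Num.floor (x zh j))%:~R.
have [xi xiP] : exists xi : 'I_n -> R, forall j, fr zh j @[zh --> G] --> xi j.
  apply: (@fin_all_exists _ (fun=> R) (fun j c => fr zh j @[zh --> G] --> c)) => j.
  apply: (ultra_segment_cvg GU (a := 0) (b := 1)) => zh.
  have /andP[fl fu] := floor_itv (x zh j).
  by rewrite subr_ge0 fl lerBlDl ltW // -[1]/(1%:~R) -intrD.
pose frC (zh : pt) : 'rV[C]_n := D%:R *: \row_j (fr zh j)%:C%C.
pose Xi : 'rV[C]_n := D%:R *: \row_j (xi j)%:C%C.
pose yR (zh : pt) : 'rV[R]_n := \row_j complex.Im (zh.1 0 j : C).
pose y (zh : pt) : 'rV[C]_n := map_mx (real_complex R) (yR zh).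
pose h' (zh : pt) := H (k zh) *m zh.2.
have frl : mxlim G frC Xi.
  apply: mxlimZl => i j; rewrite !mxE; under eq_fun do rewrite mxE.
  exact: cvg_real_complex.
have NE : N = (fun j => map_mx ratr (B j)).
  by apply/funext => j; apply: monodromy_rat.
have vecCE (g : 'cV[int]_d) : map_mx ratr (map_mx intr g : 'cV[rat]_d) = vecC R g.
  by apply/matrixP => i j; rewrite !mxE /= ratr_int.
(* Hence multiplying exp(-N(z)) h by the exponential of N([frC]) gives exp(-i N(y)) applied to the
   integral vector [h']. *)
have zE zh : frC zh - zh.1 = - 'i *: y zh + (- D%:R *: map_mx intr (k zh)).
  apply/rowP => j; rewrite !mxE.
  have -> : D%:R * (fr zh j)%:C%C =
      (complex.Re (zh.1 0 j : C))%:C%C - D%:R * (Num.floor (x zh j))%:~R :> C.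
    rewrite /fr /x (rmorphB (real_complex R)) (rmorphM (real_complex R)) fmorphV.
    rewrite (rmorph_nat (real_complex R)) (rmorph_int (real_complex R)) mulrBr.
    by rewrite mulrCA mulfV ?mulr1 // pnatr_eq0 -lt0n.
  rewrite -[X in _ - X]/(zh.1 0 j : C) [X in _ - X](complexE (zh.1 0 j : C)).
  by rewrite opprD addrACA addrA subrr add0r addrC !mulNr.
have lH zh : texp (lincomb N (- D%:R *: map_mx intr (k zh))) *m vecC R zh.2 =
    vecC R (h' zh).
  have -> : - D%:R *: map_mx intr (k zh) =
      map_mx ratr (- D%:R *: map_mx intr (k zh) : 'rV[rat]_n) :> 'rV[C]_n.
    by apply/rowP => j; rewrite !mxE rmorphM rmorphN rmorph_nat /= ratr_int.
  by rewrite NE -map_lincomb -map_texp HE -vecCE -!map_mxM vecCE.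
have lim3 : mxlim G (fun zh : pt => texp (lincomb N (- 'i *: y zh)) *m vecC R (h' zh))
    (texp (lincomb N Xi) *m p.2).
  apply: (mxlim_near _ (mxlimM (mxlim_texp (mxlim_lincomb N frl)) lim2)).
  apply: nearW => zh; rewrite (expNE T_comm T_unip) -/N.
  apply: (etrans (texp_lincomb_comp cN N0 _ _ _)); rewrite zE -lH.
  exact/esym/(texp_lincomb_comp cN N0).
have y_real zh j : y zh 0 j \is Num.real.
  by rewrite mxE realE (lecR 0) (lecR _ 0) le_total.
(* The descent on rational subspaces starts from the whole space, [E = 1%:M]. *)
have lim5 : mxlim G (fun zh : pt => texp (- 'i *: lincomb (fun j => map_mx ratr (B j))
    (y zh *m map_mx ratr (1%:M : 'M[rat]_n))) *m
    map_mx ratr (map_mx intr (h' zh) : 'cV[rat]_d))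
    (texp (lincomb N Xi) *m p.2).
  apply: (mxlim_near _ lim3); apply: nearW => zh.
  by rewrite -NE map_mx1 mulmx1 vecCE lincombZ.
have [h0 [E [b [hh0 bl Eh]]]] := bounded_distance_to_kernel cB B0 y_real lim5.
have yE zh : y zh = y zh *m map_mx ratr (1%:M - E) + y zh *m map_mx ratr E.
  by rewrite map_mxB map_mx1 mulmxBr mulmx1 subrK.
have yEh zh : lincomb N (y zh *m map_mx ratr E) *m vecC R h0 = 0.
  rewrite lincomb_mul mulmx_suml big1 // => i _.
  by rewrite -scalemxAl NE -map_row -map_lincomb -vecCE -map_mxM Eh map_mx0 scaler0.
have [a rel] : exists a, positive_relation R T a h0.
  (* The difference between y and its component along [E] tends to [b], so its coordinate j is
     eventually below [M + 1] in absolute value, while the imaginary part of z_j eventually exceeds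
     [M + 1]. *)
  have ypos j : \forall zh \near G, 0 < (yR zh *m map_mx ratr E) 0 j.
    have [M bM] : exists M : R, `|b 0 j| = M%:C%C by rewrite normc_def; eexists.
    have /cvgrPdist_lt /(_ 1 ltr01) b1 := bl 0 j.
    have yM := Im_eventually_gt GP (M + 1) (lim1 j).
    apply: filterS2 b1 yM => zh bzh yM.
    set r := _ *m _; have rC : (r 0 j)%:C%C = (y zh *m map_mx ratr E) 0 j :> C.
      rewrite !mxE (rmorph_sum (real_complex R)); apply: eq_bigr => k1 _.
      by rewrite !mxE (rmorphM (real_complex R)) fmorph_rat.
    have yC : (yR zh 0 j)%:C%C = y zh 0 j :> C by rewrite [RHS]mxE.
    have yrE : (yR zh 0 j - r 0 j)%:C%C = (y zh *m map_mx ratr (1%:M - E)) 0 j :> C.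
      apply: (etrans (rmorphB (real_complex R) _ _)).
      apply: (etrans (congr2 (fun u v : C => u - v) yC rC)).
      by rewrite {1}yE mxE addrK.
    have yrM : `|((yR zh 0 j - r 0 j)%:C%C : C)| < (M + 1)%:C%C.
      rewrite yrE (rmorphD (real_complex R)) /= -bM -[X in `|X| < _](subrK (b 0 j)) addrC.
      by rewrite (le_lt_trans (ler_normD _ _)) // ltrD2l distrC.
    move: yrM; rewrite normc_def /= expr0n addr0 sqrtr_sqr ltcR => yrM.
    have := lt_trans (le_lt_trans (ler_norm _) yrM) yM.
    by rewrite mxE ltrBlDr ltrDl.
  have [zh zhP] := filter_ex (@filter_forall pt 'I_n _ G GP ypos).
  exact: positive_relation_ex zhP Eh.
(* The two computations of one limit give exp(N(Xi)) p.2 = exp(-i N(b)) h0; solving for [p.2]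
   dictates this [w]. *)
exists h0, a, (Xi + 'i *: b); split=> //.
rewrite [p]surjective_pairing p10; congr pair.
have lim4 : mxlim G (fun zh : pt => texp (lincomb N (- 'i *: y zh)) *m vecC R (h' zh))
    (texp (lincomb N (- 'i *: b)) *m vecC R h0).
  apply: (mxlim_near _ (mxlimM (mxlim_texp (mxlim_lincomb N (mxlimZl (- 'i) bl)))
    (mxlim_cst (vecC R h0)))).
  apply: filterS hh0 => zh ->; rewrite [in RHS]yE scalerDr.
  apply: (esym (texp_lincomb_fix cN N0 _ _)).
  by rewrite lincombZ -scalemxAl yEh scaler0.
rewrite (expNE T_comm T_unip) opprD addrC -scaleNr.
exact: (texp_lincomb_solve cN N0 (mxlim_unique lim3 lim4)).
Qed.

End Forward.

Theorem proposition2 (R : realType) (n d : nat) (T : 'I_n -> 'M[int]_d)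
    (T_unit : forall j, T j \in unitmx)
    (T_comm : forall i j, T i *m T j = T j *m T i)
    (T_unip : forall j, unipotent (T j)) :
  (forall p : 'rV[C R]_n * 'cV[C R]_d,
     disk_bundle p -> p.1 = 0 ->
     (embedding_closure T p <->
      exists (h : 'cV[int]_d) (a : 'I_n -> nat) (w : 'rV[C R]_n),
        positive_relation R T a h /\ p = (0, expN T w h)))
  /\
  (forall (h : 'cV[int]_d) (a : 'I_n -> nat) (w : 'rV[C R]_n),
     positive_relation R T a h ->
     exists eps : R, 0 < eps /\
       [/\ forall t : C R, `|t| < eps%:C%C -> disk_bundle (limit_arc T a w h t),
           forall t : C R, `|t| < eps%:C%C -> t != 0 ->
             embedding_image T (limit_arc T a w h t)
         & limit_arc T a w h 0 = (0, expN T w h)]).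
Proof.
split=> [p pA p10|h a w rel].
  split=> [|[h [a [w [rel ->]]]]]; first exact: closure_point.
  exact: arc_point_in_closure rel.
have [eps [eps0 disk]] := limit_arc_disk T h w rel.1.
exists eps; split=> //; split=> // [t te t0|].
  by apply: limit_arc_image => //; apply: disk.
congr pair; apply/rowP => j; rewrite !mxE expr0n gtn_eqF ?mul0r //.
exact: rel.1.
Qed.
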